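(* Let $X$ be a compact countably infinite metrizable space. Then every compact metric space can be bi-Lipschitz embedded into $(\mathrm{Met}(X),\mathcal{D}_X)$.
   Context: For a metrizable space $X$, $\mathrm{Met}(X)$ is the set of all metrics on $X$ that generate the given topology of $X$, equipped with the sup-metric $\mathcal{D}_X(d,e)=\sup_{x,y\in X}|d(x,y)-e(x,y)|$. A bi-Lipschitz embedding $f\colon(K,\rho)\to(M,\sigma)$ is a map for which there is a constant $C\ge 1$ with $C^{-1}\rho(x,y)\le\sigma(f(x),f(y))\le C\rho(x,y)$ for all $x,y\in K$. *)

(* Defs.v *)
From HB Require Import structures.
From mathcomp Require Import all_boot all_order all_algebra.
From mathcomp Require Import all_classical all_reals all_analysis.

Set Implicit Arguments.
Unset Strict Implicit.
Unset Printing Implicit Defensive.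

Import Order.TTheory GRing.Theory Num.Theory.
Import numFieldNormedType.Exports.

Local Open Scope classical_set_scope.
Local Open Scope ring_scope.

Definition is_metric (R : realType) (X : Type) (d : X -> X -> R) : Prop :=
  [/\ forall x y, 0 <= d x y,
      forall x y, d x y = 0 <-> x = y,
      forall x y, d x y = d y x &
      forall x y z, d x z <= d x y + d y z].

Definition generates_topology (R : realType) (X : topologicalType)
    (d : X -> X -> R) : Prop :=
  forall A : set X, open A <->
    forall x, A x -> exists2 e : R, 0 < e & [set y | d x y < e] `<=` A.

Definition Met (R : realType) (X : topologicalType) : set (X -> X -> R) :=
  [set d | is_metric d /\ generates_topology d].
Arguments Met : clear implicits.

Definition metrizable (R : realType) (X : topologicalType) : Prop :=
  exists d : X -> X -> R, Met R X d.

(* The supremum is taken in the extended reals: it may be +oo when X is not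
   compact. It is -oo, rather than 0, only when X is empty. *)
Definition sup_metric (R : realType) (X : Type) (d e : X -> X -> R) : \bar R :=
  ereal_sup [set (`|d p.1 p.2 - e p.1 p.2|)%:E | p in [set: X * X]].

(* The target space is a subset S of M, with an extended-real distance. *)
Definition bilipschitz_embedding (R : realType) (K : metricType R) (M : Type)
    (S : set M) (sigma : M -> M -> \bar R) (f : K -> M) : Prop :=
  (forall x, S (f x)) /\
  exists2 C : R, 1 <= C &
    forall x y, ((C^-1 * mdist x y)%:E <= sigma (f x) (f y))%E /\
                (sigma (f x) (f y) <= (C * mdist x y)%:E)%E.

(* Main.v *)
(* If [g : X -> R] is continuous then [d x y + `|g x - g y|] is again a metric
   generating the topology of [X]. An infinite compact [X] has a limit point
   [q] and points [p n] whose distances to [q] shrink geometrically; bumps of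
   height [F n] in the variable [d x q], vanishing at [q] and at the other
   points [p m], have as supremum a continuous [g] with [g q = 0] and
   [g (p n) = F n], for every [F] dominated by a fixed null sequence. The
   distance between the metrics of [F] and [F'] is then between one and two
   times the sup distance of [F] and [F'], so it is enough to embed the compact
   space in the sequences dominated by a null sequence. *)

From HB Require Import structures.
Require Import Defs.
From mathcomp Require Import all_boot all_order all_algebra.
From mathcomp Require Import all_classical all_reals all_analysis.
From mathcomp Require Import ring lra.

Import Order.TTheory GRing.Theory Num.Theory.
Import numFieldNormedType.Exports.
Local Open Scope classical_set_scope.
Local Open Scope card_scope.
Local Open Scope ring_scope.

(** * Metrics generating a given topology *)

Lemma ler_distB (R : numDomainType) (a b : R) (c e : R) :
  `|(a - b) - (c - e)| <= `|a - c| + `|b - e|.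
Proof.
have -> : a - b - (c - e) = (a - c) - (b - e) by ring.
exact: ler_normB.
Qed.

Lemma Met_nbhsP (R : realType) (X : topologicalType) (d : X -> X -> R)
    (x : X) (A : set X) : Met R X d ->
  nbhs x A <-> exists2 e : R, 0 < e & [set y | d x y < e] `<=` A.
Proof.
move=> [[d_ge0 d_eq0 d_sym d_tri] d_top]; split.
  rewrite nbhsE => -[B [/d_top oB Bx] BA].
  by have [e e0 eB] := oB x Bx; exists e => //; apply: subset_trans BA.
move=> [e e0 eA]; rewrite nbhsE; exists [set y | d x y < e] => //.
split; last by rewrite /= (d_eq0 x x).2.
apply/d_top => y /= dxy; exists (e - d x y); first by rewrite subr_gt0.
by move=> z /=; have := d_tri x y z; lra.
Qed.

(** The new metric dominates [d], so [d]-open sets stay open. Conversely, continuity of [g] puts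
    inside each new ball of radius [e] a [d]-ball on which both summands stay below [e / 2]. *)
Lemma Met_add_dist (R : realType) (X : topologicalType) (d : X -> X -> R)
    (g : X -> R) : Met R X d -> continuous g ->
  Met R X (fun x y => d x y + `|g x - g y|).
Proof.
move=> dMet g_cont; have [[d_ge0 d_eq0 d_sym d_tri] d_top] := dMet.
split; [split|].
- by move=> x y; rewrite addr_ge0.
- move=> x y; split=> [/eqP|->]; last by rewrite subrr normr0 addr0 d_eq0.
  by rewrite paddr_eq0// => /andP[/eqP /d_eq0].
- by move=> x y; rewrite d_sym distrC.
- move=> x y z; have := d_tri x y z; have := ler_distD (g y) (g x) (g z).
  by lra.
move=> A; rewrite d_top; split=> oA x Ax; have [e e0 eA] := oA x Ax.
  exists e => // y /= dxy; apply: eA => /=.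
  by have := normr_ge0 (g x - g y); lra.
have : nbhs x [set y | `|g x - g y| < e / 2].
  by have /cvgrPdist_lt := g_cont x; apply; rewrite divr_gt0.
move=> /(Met_nbhsP _ _ _ _ _ dMet)[r r0 rP].
exists (Num.min r (e / 2)); first by rewrite lt_min r0 divr_gt0.
move=> y /=; rewrite lt_min => /andP[dr de]; apply: eA => /=.
by have := rP y dr => /=; lra.
Qed.

(** * Cluster points, and sequences approaching a limit point geometrically *)

Lemma compact_seq_cluster (T : topologicalType) (u : nat -> T) :
  compact [set: T] ->
  exists x : T, forall U, nbhs x U -> forall N, exists2 n, (N <= n)%N & U (u n).
Proof.
move=> /(_ (u @ \oo) _ filterT)[x [_ ux]]; exists x => U xU N.
have [|_ [[n /= Nn <-] Un]] := ux (u @` [set n | (N <= n)%N]) U _ xU.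
  by exists N => // n /= Nn; exists n.
by exists n.
Qed.

(** Two terms of [u] with different indices lie within [e] of a cluster point, and by injectivity at
    most one of them equals it. *)
Lemma compact_limit_point (R : realType) (X : topologicalType)
    (d : X -> X -> R) (u : nat -> X) :
  Met R X d -> compact [set: X] -> injective u ->
  exists q, forall e : R, 0 < e -> exists x, 0 < d x q < e.
Proof.
move=> dMet X_compact u_inj; have [[d_ge0 d_eq0 d_sym d_tri] _] := dMet.
have [q uq] := compact_seq_cluster _ u X_compact; exists q => e e0.
have {}uq : forall N, exists2 n, (N <= n)%N & d q (u n) < e.
  apply: (uq [set y | d q y < e]).
  by apply/(Met_nbhsP _ _ _ _ _ dMet); exists e.
have [m _ dm] := uq 0; have [n mn dn] := uq m.+1.
have pos x : x <> q -> 0 < d x q.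
  move=> xq; rewrite lt_neqAle d_ge0 andbT eq_sym.
  by apply/eqP => /d_eq0.
have [umq|umq] := pselect (u m = q); last first.
  by exists (u m); rewrite pos// d_sym.
exists (u n); rewrite d_sym dn andbT d_sym; apply: pos => unq.
by move: mn; rewrite (u_inj m n) ?ltnn// umq.
Qed.

Lemma halving_seq (R : realType) (T : Type) (t : T -> R) :
  (forall e : R, 0 < e -> exists x, 0 < t x < e) ->
  exists p : nat -> T,
    forall n, 0 < t (p n) /\ t (p n.+1) <= t (p n) / 2.
Proof.
move=> t_small.
have [p0 /andP[p0_gt0 _]] := t_small 1 ltr01.
(* The premise [0 < t x] makes [s] total: where it fails, any value serves. *)
have /choice[s sP] (x : T) : exists y, 0 < t x -> 0 < t y <= t x / 2.
  have [x0|] := boolP (0 < t x); last by exists x.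
  have [|y /andP[y0 yx]] := t_small (t x / 2); first by rewrite divr_gt0.
  by exists y => _; rewrite y0 ltW.
have p_gt0 n : 0 < t (iter n s p0) by elim: n => //= n /sP/andP[].
by exists (fun n => iter n s p0) => n; have /andP[] := sP _ (p_gt0 n).
Qed.

(** Iterated halving gives [2 * t n <= t m] for [m < n], so no other term comes closer to [t n] than
    [t n / 2]. This is the room in which a bump at [t n] must die out. *)
Lemma halving_gap (R : realType) (t : nat -> R) :
  (forall n, 0 < t n /\ t n.+1 <= t n / 2) ->
  forall m n, m != n -> t n <= 2 * `|t m - t n|.
Proof.
move=> tP.
have gap m n : (m < n)%N -> 2 * t n <= t m.
  elim: n => // n IH; rewrite ltnS leq_eqVlt => /orP[/eqP->|/IH];
  by have [] := tP n; lra.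
move=> m n; have [tm _] := tP m; have [tn _] := tP n.
case: ltngtP => // /gap ? _; last by rewrite distrC ger0_norm; lra.
by rewrite ger0_norm; lra.
Qed.

(** * Suprema of sequences and interpolation by bumps *)

Lemma sup_range_dist (R : realType) (u v : nat -> R) (c : R) :
  has_ubound (range u) -> has_ubound (range v) ->
  (forall n, `|u n - v n| <= c) -> `|sup (range u) - sup (range v)| <= c.
Proof.
move=> ubu ubv uvc.
suff H (w z : nat -> R) : has_ubound (range z) ->
    (forall n, `|w n - z n| <= c) -> sup (range w) - sup (range z) <= c.
  rewrite ler_norml lerNl opprB !H// => n; by rewrite distrC.
move=> ubz wzc; rewrite lerBlDr; apply: ge_sup; first by exists (w 0), 0%N.
move=> _ [n _ <-].
have : z n <= sup (range z) by apply: ub_le_sup => //; exists n.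
by have := wzc n; have := ler_norm (w n - z n); lra.
Qed.

Lemma sup_range_max (R : realType) (u : nat -> R) (n : nat) :
  (forall m, u m <= u n) -> sup (range u) = u n.
Proof.
move=> un; apply/le_anti/andP; split.
  by apply: ge_sup => [|_ [m _ <-]]; first by exists (u n), n.
by apply: ub_le_sup; [exists (u n) => _ [m _ <-]|exists n].
Qed.

Lemma ler_dist_max0 (R : realDomainType) (a b : R) :
  `|Num.max 0 a - Num.max 0 b| <= `|a - b|.
Proof.
have H (x y : R) : Num.max 0 x - Num.max 0 y <= `|x - y|.
  rewrite lerBlDr ge_max; apply/andP; split.
    by rewrite addr_ge0// le_max lexx.
  have : y <= Num.max 0 y by rewrite le_max lexx orbT.
  by have := ler_norm (x - y); lra.
by rewrite ler_norml H lerNl opprB distrC H.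
Qed.

Lemma c0_interpolation (R : realType) (X : topologicalType) (d : X -> X -> R)
    (q : X) (p : nat -> X) (eps : nat -> R) :
  Met R X d ->
  (forall n, 0 < d (p n) q /\ d (p n.+1) q <= d (p n) q / 2) ->
  (forall n, 0 <= eps n) -> eps @ \oo --> (0 : R) ->
  exists G : (nat -> R) -> X -> R,
    (forall F, (forall n, 0 <= F n <= eps n) ->
      [/\ G F q = 0, forall n, G F (p n) = F n & continuous (G F)]) /\
    (forall F F' c, (forall n, 0 <= F n <= eps n) ->
      (forall n, 0 <= F' n <= eps n) -> (forall n, `|F n - F' n| <= c) ->
      forall x, `|G F x - G F' x| <= c).
Proof.
move=> dMet pP eps_ge0 eps_cvg; have [[d_ge0 d_eq0 d_sym d_tri] _] := dMet.
(* [L n] is the slope of the tent at [t n]: a height of at most [eps n] drops to zero within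
   [t n / 2]. Since it does not depend on [F], each tent is 1-Lipschitz in [F n]. *)
pose t n := d (p n) q; pose L n := 2 * eps n / t n.
have t_gt0 n : 0 < t n by have [] := pP n.
have t_gap := @halving_gap _ t pP.
have L_ge0 n : 0 <= L n by rewrite divr_ge0 ?mulr_ge0// ltW.
have Lt n s : t n <= 2 * s -> eps n <= L n * s.
  move=> /(ler_wpM2l (eps_ge0 n)) ts.
  by rewrite /L mulrAC ler_pdivlMr//; lra.
pose u F n x : R := Num.max 0 (F n - L n * `|d x q - t n|).
exists (fun F x => sup (range (fun n => u F n x))).
have [M epsM] : exists M, forall n, eps n <= M.
  have /cvg_seq_bounded[M [_ /(_ (M + 1))]] : cvg (eps @ \oo).
    exact: (cvgP _ eps_cvg).
  rewrite ltrDl => /(_ ltr01) epsM; exists (M + 1) => n.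
  exact: le_trans (ler_norm _) (epsM n I).
have u_ge0 F n x : 0 <= u F n x by rewrite le_max lexx.
have u_le F n x : 0 <= F n <= eps n -> u F n x <= eps n.
  move=> /andP[_ Fe]; rewrite ge_max eps_ge0 (le_trans _ Fe)//.
  by rewrite gerBl mulr_ge0.
have ubu F x : (forall n, 0 <= F n <= eps n) ->
    has_ubound (range (fun n => u F n x)).
  move=> FP; exists M => _ [n _ <-]; apply: le_trans (epsM n); exact: u_le.
have u0 F n x : 0 <= F n <= eps n -> t n <= 2 * `|d x q - t n| -> u F n x = 0.
  move=> /andP[_ Fe] /Lt eL; apply/max_idPl; rewrite subr_le0.
  exact: le_trans eL.
split=> [F FP|F F' c FP F'P FF' x]; last first.
  apply: sup_range_dist => [||n]; [exact: ubu..|].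
  apply: le_trans (ler_dist_max0 _ _ _) _.
  by rewrite [X in `|X|](_ : _ = F n - F' n)//; ring.
have uq n : u F n q = 0.
  rewrite u0// (d_eq0 q q).2// sub0r normrN gtr0_norm//.
  by have := t_gt0 n; lra.
split.
- by rewrite (@sup_range_max _ _ 0%N) ?uq// => m; rewrite !uq.
- move=> n; have un : u F n (p n) = F n.
    rewrite /u subrr normr0 mulr0 subr0; apply/max_idPr.
    by have /andP[] := FP n.
  rewrite (@sup_range_max _ _ n) => [//|m]; have [->//|mn] := eqVneq m n.
  by rewrite u0// t_gap// eq_sym.
move=> x; apply/cvgrPdist_le => /= e e0.
(* Tents from index [N] on take values in [[0, e]]; each of the first [N] is Lipschitz with constant
   at most the sum of the [L i]. The added 1 keeps the divisor positive. *)
have /cvgrPdist_le/(_ e e0)[N _ epsN] := eps_cvg.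
have S_gt0 : 0 < 1 + \sum_(i < N) L i.
  by rewrite ltr_pwDl// sumr_ge0.
apply/(Met_nbhsP _ _ _ _ _ dMet).
exists (e / (1 + \sum_(i < N) L i)); first by rewrite divr_gt0.
move=> y /=; rewrite ltr_pdivlMr// => dxy.
apply: sup_range_dist => [||n]; [exact: ubu..|].
have [Nn|nN] := leqP N n.
  have := epsN n Nn; rewrite sub0r normrN (ger0_norm (eps_ge0 n)) => epse.
  have := u_le F n x (FP n); have := u_le F n y (FP n).
  by rewrite ler_norml; have := u_ge0 F n x; have := u_ge0 F n y; lra.
apply: le_trans (ler_dist_max0 _ _ _) _.
have -> : F n - L n * `|d x q - t n| - (F n - L n * `|d y q - t n|)
  = L n * (`|d y q - t n| - `|d x q - t n|) by ring.
have dq : `| `|d y q - t n| - `|d x q - t n| | <= d x y.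
  apply: le_trans (ler_dist_dist _ _) _.
  have -> : d y q - t n - (d x q - t n) = d y q - d x q by ring.
  have := d_tri x y q; have := d_tri y x q.
  by rewrite (d_sym y x) ler_norml; lra.
rewrite normrM (ger0_norm (L_ge0 n)); apply: le_trans (ltW dxy).
rewrite mulrC; apply: ler_pM => //.
by rewrite (bigD1 (Ordinal nN))//= addrCA lerDl addr_ge0// sumr_ge0.
Qed.

(** * Compact metric spaces inside the null sequences *)

Lemma compact_dense_seq (R : realType) (K : metricType R) (k0 : K) :
  compact [set: K] ->
  exists k : nat -> K, forall a (e : R), 0 < e -> exists n, mdist a (k n) < e.
Proof.
pose Kp : pseudoPMetricType R := HB.pack (K : Type) K (isPointed.Build K k0).
move=> /(@compact_second_countable R Kp)[B /countable_injP[c c_inj] [_ Bnbhs]].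
(* A point of the basic open set numbered [n], with default [k0] if there is none. *)
pose k n := xget k0 [set x | exists2 U, B U & c U = n /\ U x].
exists k => a e e0.
have [U [BU Ua] aeU] := Bnbhs a _ (nbhsx_ballx a e e0).
exists (c U); rewrite /k; case: xgetP => [x _ [V BV [cVU Vx]]|/(_ a)[]].
  have VU : V = U by apply: c_inj; rewrite ?inE.
  by move: Vx; rewrite VU => /aeU; rewrite ballEmdist.
by exists U.
Qed.

(** Otherwise each [N] gives [a N] at distance at least [e] from the first [N] points. Some [k i]
    lies within [e / 2] of a cluster point, and so does some [a n] with [i < n]: a contradiction. *)
Lemma compact_dense_gap (R : realType) (K : metricType R) (k : nat -> K) :
  compact [set: K] ->
  (forall a (e : R), 0 < e -> exists n, mdist a (k n) < e) ->
  forall e : R, 0 < e ->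
    exists N, forall n, (N <= n)%N ->
      forall a, exists2 i, (i < n)%N & mdist a (k i) < e.
Proof.
move=> K_compact k_dense e e0; apply: contrapT => Nn.
have /choice[a aP] N : exists a, forall i, (i < N)%N -> e <= mdist a (k i).
  apply: contrapT => aN; apply: Nn; exists N => n Nn a.
  apply: contrapT => an; apply: aN; exists a => i iN; rewrite leNgt.
  apply/negP => aki; apply: an; exists i => //; exact: leq_trans Nn.
have [x ax] := compact_seq_cluster _ a K_compact.
have e20 : 0 < e / 2 by rewrite divr_gt0.
have [i xki] := k_dense x _ e20.
have [n Nin] := ax _ (nbhsx_ballx x _ e20) i.+1.
rewrite ballEmdist /= => xan.
have := aP n i Nin; have := metric_triangle (a n) x (k i).
by rewrite (metric_sym (a n) x); lra.
Qed.

Lemma compact_mdist_bounded (R : realType) (K : metricType R) :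
  compact [set: K] -> exists D : R, forall a b : K, mdist a b <= D.
Proof.
move=> K_compact.
have [[k0]|K0] := pselect (exists k0 : K, True); last first.
  by exists 0 => a; case: K0; exists a.
suff [D DP] : exists D : R, forall a, mdist k0 a <= D.
  exists (D + D) => a b; have := metric_triangle a k0 b.
  by rewrite (metric_sym a k0); have := DP a; have := DP b; lra.
apply: contrapT => Dn.
have /choice[a aP] (n : nat) : exists a, n%:R < mdist k0 a.
  apply: contrapT => an; apply: Dn; exists n%:R => a; rewrite leNgt.
  by apply/negP => ab; apply: an; exists a.
have [x ax] := compact_seq_cluster _ a K_compact.
(* A term within 1 of [x] is at distance less than [mdist k0 x + 1] from [k0], so an index above
   that bound contradicts [aP]. *)
have [n Nn] := ax _ (nbhsx_ballx x 1 ltr01) (Num.truncn (mdist k0 x + 1)).+1.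
rewrite ballEmdist /= => xan.
have := truncnS_gt (mdist k0 x + 1); have := aP n.
have := metric_triangle k0 x (a n); move: Nn; rewrite -(ler_nat R); lra.
Qed.

(* Frechet's embedding truncated at four times the covering radius
   [sup_a min_(i < n) mdist a (k i)] of the first [n] points, which is [sup (S n)]
   (the cap [D] makes it finite for [n = 0]). If [n] is least with
   [mdist a (k n) < mdist a b / 4], then [mdist a b / 4 <= sup (S n)], so that
   truncation keeps [mdist a b / 2] of the gap in the [n]-th coordinate. *)
Lemma compact_c0_embedding (R : realType) (K : metricType R) (k0 : K) :
  compact [set: K] ->
  exists (eps : nat -> R) (F : K -> nat -> R),
    [/\ eps @ \oo --> (0 : R),
        forall a n, 0 <= F a n <= eps n,
        forall a b n, `|F a n - F b n| <= mdist a b &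
        forall a b, exists n, mdist a b / 2 <= `|F a n - F b n|].
Proof.
move=> K_compact; have [k k_dense] := compact_dense_seq _ _ k0 K_compact.
have [D DP] := compact_mdist_bounded _ _ K_compact.
have D0 : 0 <= D by apply: le_trans (DP k0 k0); rewrite mdist_ge0.
pose S n := [set r : R | 0 <= r <= D /\
  exists a, forall i, (i < n)%N -> r <= mdist a (k i)].
have S0 n : S n 0.
  by split; [rewrite lexx|exists k0 => i _; exact: mdist_ge0].
have S_ub n : has_ubound (S n) by exists D => r [/andP[]].
have s_ge0 n : 0 <= sup (S n) by apply: ub_le_sup.
exists (fun n => 4 * sup (S n)).
exists (fun a n => Num.min (mdist a (k n)) (4 * sup (S n))).
split.
- apply/cvgrPdist_le => e e0.
  have [|N NP] := compact_dense_gap _ _ _ K_compact k_dense (e / 4).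
    by rewrite divr_gt0.
  exists N => // n /= Nn; rewrite sub0r normrN ger0_norm ?mulr_ge0//.
  suff : sup (S n) <= e / 4 by lra.
  apply: ge_sup => [|r [_ [a ar]]]; first by exists 0.
  have [i ni aki] := NP n Nn a; exact: le_trans (ar i ni) (ltW aki).
- by move=> a n; rewrite le_min mdist_ge0 mulr_ge0//= ge_min lexx orbT.
- move=> a b n.
  have := metric_triangle a b (k n); have := metric_triangle b a (k n).
  rewrite (metric_sym b a) => tri_b tri_a; have ab_ge0 := mdist_ge0 a b.
  by rewrite /Num.min; do 2 case: ltP => ?; rewrite ler_norml; lra.
move=> a b; have [->|ab] := eqVneq a b.
  by exists 0%N; rewrite mdistxx mul0r.
have ab0 : 0 < mdist a b by rewrite mdist_gt0.
have ex_n : exists n, mdist a (k n) < mdist a b / 4.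
  by apply: k_dense; rewrite divr_gt0.
case: (ex_minnP ex_n) => n akn n_min; exists n.
have abs : mdist a b / 4 <= sup (S n).
  apply: ub_le_sup => //; split.
    by have := DP a b; lra.
  exists a => i ni; rewrite leNgt; apply/negP => /n_min.
  by rewrite leqNgt ni.
(* The point [k n] is farther than three quarters of [mdist a b] from [b], and the truncation level
   is at least [mdist a b]. So the coordinate of [b] is at least three quarters of [mdist a b], that
   of [a] less than one quarter. *)
have := metric_triangle a (k n) b; rewrite (metric_sym (k n) b) => tri.
rewrite distrC ler_normr; apply/orP; left.
by rewrite /Num.min; do 2 case: ltP => ?; lra.
Qed.

Theorem corollary1p10 (R : realType) (X : topologicalType)
    (X_metrizable : metrizable R X)
    (X_compact : compact [set: X])
    (X_countably_infinite : [set: X] #= [set: nat])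
    (K : metricType R) (K_compact : compact [set: K]) :
  exists f : K -> (X -> X -> R),
    bilipschitz_embedding (Met R X) (@sup_metric R X) f.
Proof.
have [[k0 _]|K0] := pselect (exists k0 : K, True); last first.
  (* On an empty [K] every map qualifies vacuously. *)
  exists (fun _ _ _ => 0); split=> [a|]; first by case: K0; exists a.
  by exists 1 => // a; case: K0; exists a.
have [d dMet] := X_metrizable.
have [u u_inj] : exists u : nat -> X, injective u.
  have /card_set_bijP[f [_ _ f_surj]] := X_countably_infinite.
  have /choice[u fu] (n : nat) : exists x, f x = n.
    by have [x _ fx] := f_surj n I; exists x.
  by exists u; exact: can_inj fu.
have [q q_limit] := compact_limit_point _ _ _ _ dMet X_compact u_inj.
have [p pP] := halving_seq _ _ (fun x => d x q) q_limit.
have [eps [F [eps_cvg F_le F_lip F_sep]]] :=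
  compact_c0_embedding _ _ k0 K_compact.
have eps_ge0 n : 0 <= eps n by have /andP[] := F_le k0 n; exact: le_trans.
have [G [GP G_lip]] := c0_interpolation _ _ _ _ _ _ dMet pP eps_ge0 eps_cvg.
exists (fun a x y => d x y + `|G (F a) x - G (F a) y|); split=> [a|].
  by apply: Met_add_dist => //; have [] := GP _ (F_le a).
(* The lower factor 1/2 comes from [F_sep], read off at the pair [(p n, q)], where [G] vanishes at
   [q]. The upper factor 2 comes from the two points [x] and [y], each contributing at most
   [mdist a b]. *)
exists 2 => [|a b]; first by rewrite ler1n.
have [Gaq Gap _] := GP _ (F_le a); have [Gbq Gbp _] := GP _ (F_le b).
split.
  have [n Fn] := F_sep a b.
  apply: le_trans (_ : (`|F a n - F b n|%:E <= _)%E).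
    by rewrite lee_fin mulrC.
  apply: ereal_sup_ubound; exists (p n, q) => //=.
  rewrite Gaq Gbq Gap Gbp !subr0.
  have /andP[Fa _] := F_le a n; have /andP[Fb _] := F_le b n.
  by rewrite (ger0_norm Fa) (ger0_norm Fb) opprD addrACA subrr add0r.
apply: ge_ereal_sup => _ [[x y] _ <-] /=; rewrite lee_fin.
rewrite opprD addrACA subrr add0r.
apply: le_trans (ler_dist_dist _ _) _.
apply: le_trans (ler_distB _ _ _ _ _) _.
have := G_lip _ _ _ (F_le a) (F_le b) (F_lip a b).
by move=> H; have := H x; have := H y; lra.
Qed.
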